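(* Let $q=2^\nu$ for some $\nu\ge 1$, let $k$ and $T$ be integers such that $0\le T<k$, let $\theta(\alpha)=\alpha^{q^T}$ on $\mathbb{F}_{q^k}$, and let $n=n_02^r$ with $r\ge 1$ and $n_0\ge1$ odd. Assume that the map $\sigma: Q\mapsto -q^TQ$ is an involution on the set of $q^k$-cyclotomic classes modulo $n_0$. Then every orbit represented by an element of $\Omega_2$ has size $2$. A repeated-root cyclic code $C=\langle g(x)\rangle$ of length $n$ over $\mathbb{F}_{q^k}$ with generator polynomial $g(x)$ is Galois self-dual (that is, $\theta$-self-dual) if and only if $$g(x)=\left(\prod_{Q\in \Omega_1} f_Q(x)^{2^{r-1}}\right)\left(\prod_{Q\in \Omega_2} f_Q(x)^{b_Q}f_{\sigma(Q)}(x)^{2^r-b_Q}\right)$$ for some integers $b_Q$ with $0\le b_Q\le 2^r$ ($Q\in\Omega_2$). Consequently, the number of Galois self-dual repeated-root cyclic codes of length $n$ over $\mathbb{F}_{q^k}$ is $(2^r+1)^{|\Omega_2|}$.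
   Context: Cyclic codes of length $n$ over $\mathbb{F}_{q^k}$ are identified with ideals of $\mathbb{F}_{q^k}[x]/\langle x^n-1\rangle$ via $(c_0,\dots,c_{n-1})\mapsto\sum c_ix^i$; each is $\langle g(x)\rangle$ for a unique monic divisor $g(x)$ of $x^n-1$, its generator polynomial. Since $r\ge1$, every cyclic code of length $n$ here is a repeated-root cyclic code. The $\theta$-form on $\mathbb{F}_{q^k}^n$ is $[u,v]_\theta=\sum_{i=0}^{n-1}u_i\theta(v_i)$, and $C^{\perp_\theta}=\{v\in\mathbb{F}_{q^k}^n:[v,c]_\theta=0\text{ for all }c\in C\}$. The code $C$ is Galois self-dual ($\theta$-self-dual) if $C=C^{\perp_\theta}$. The $q^k$-cyclotomic class of $i\in\mathbb{Z}_{n_0}$ is $\{q^{kj}i\bmod n_0:j\ge0\}$. Fix a primitive $n_0$th root of unity $\zeta$ in an extension of $\mathbb{F}_{q^k}$ and set $f_Q(x)=\prod_{i\in Q}(x-\zeta^i)$ for each $q^k$-cyclotomic class $Q\subseteq\mathbb{Z}_{n_0}$; these are the monic irreducible factors of $x^{n_0}-1$ over $\mathbb{F}_{q^k}$. Here $-q^TQ=\{-q^Ti\bmod n_0:i\in Q\}$; $\sigma$ is a permutation of the set of $q^k$-cyclotomic classes modulo $n_0$, and ''involution'' means $\sigma\circ\sigma$ is the identity. Choose one representative in each $\sigma$-orbit; $\Omega_1$ is the set of representatives of the orbits of size $1$, and $\Omega_2$ is the set of representatives of the orbits of size greater than $1$. *)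

(* Defs.v *)
From HB Require Import structures.
From mathcomp Require Import all_boot all_algebra.

Set Implicit Arguments.
Unset Strict Implicit.
Unset Printing Implicit Defensive.

Import GRing.Theory.
Local Open Scope ring_scope.

Section Codes.
Variables (F : finFieldType) (n : nat).
Implicit Types (c u v : 'rV[F]_n) (C : {set 'rV[F]_n}) (g : {poly F}).

(* (c_0, ..., c_(n-1)) |-> (c_(n-1), c_0, ..., c_(n-2)) *)
Definition cyclic_shift c : 'rV[F]_n := \row_(i < n) c 0 (ord_pred i).

Definition linear_code C : bool :=
  (0 \in C) && [forall a : F, forall u in C, forall v in C, a *: u + v \in C].

Definition cyclic_code C : bool :=
  linear_code C && [forall c in C, cyclic_shift c \in C].

(* The ideal of F[x]/<x^n - 1> generated by g: a residue class is represented *)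
(* by its remainder modulo x^n - 1, and the word (c_0, ..., c_(n-1)) is       *)
(* identified with the polynomial rVpoly c = \sum_i c_i x^i.                  *)
Definition ideal_code g : {set 'rV[F]_n} :=
  [set poly_rV ((rVpoly a * g) %% ('X^n - 1)) | a : 'rV[F]_n].

Definition generator_poly C g : Prop :=
  [/\ g \is monic, g %| 'X^n - 1 & C = ideal_code g].

Definition galois_form (theta : F -> F) u v : F :=
  \sum_(i < n) u 0 i * theta (v 0 i).

Definition galois_dual (theta : F -> F) C : {set 'rV[F]_n} :=
  [set v | [forall c in C, galois_form theta v c == 0]].

Definition galois_self_dual (theta : F -> F) C : bool :=
  C == galois_dual theta C.

End Codes.

Definition frob_pow (F : finFieldType) (q T : nat) (a : F) : F := a ^+ (q ^ T).

(* Z_n0 is represented by its residues 'I_n0; 'Z_n0 would be wrong for n0 = 1. *)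
Local Open Scope nat_scope.

Section Cyclotomic.
Variable n0 : nat.
Implicit Types (i j : 'I_n0) (Q : {set 'I_n0}).

(* {s^t * i mod n0 : t >= 0}, see cyclotomic_classP *)
Definition cyclotomic_class (s : nat) i : {set 'I_n0} :=
  [set j | connect [rel a b : 'I_n0 | b == s * a %[mod n0]] i j].

Lemma cyclotomic_classP (s : nat) i j :
  reflect (exists t : nat, j = (s ^ t * i) %% n0 :> nat)
          (j \in cyclotomic_class s i).
Proof.
rewrite inE; apply: (iffP connectP) => [[p]|[t]].
  elim: p i => [|k p IHp] i /=.
    by move=> _ ->; exists 0; rewrite mul1n modn_small.
  case/andP=> /eqP Ek kp jE; have [t ->] := IHp _ kp jE.
  by exists t.+1; rewrite expnSr -mulnA -[RHS]modnMmr -Ek modnMmr.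
elim: t j => [|t IHt] j jE.
  by exists [::] => //=; apply: val_inj; rewrite /= jE mul1n modn_small.
have n0_gt0 : 0 < n0 by apply: leq_ltn_trans (ltn_ord i).
have [p ip lp] := IHt (Ordinal (ltn_pmod (s ^ t * i) n0_gt0)) erefl.
exists (rcons p j); last by rewrite last_rcons.
by rewrite rcons_path ip -lp /= jE modn_mod modnMmr expnS mulnA.
Qed.

Definition cyclotomic_classes (s : nat) : {set {set 'I_n0}} :=
  [set cyclotomic_class s i | i : 'I_n0].

(* - m Q = {- m i mod n0 : i in Q}: j is the residue of - m i iff n0 | j + m i *)
Definition opp_mul_class (m : nat) Q : {set 'I_n0} :=
  [set j : 'I_n0 | [exists i in Q, n0 %| j + m * i]].

Definition fun_orbit (f : {set 'I_n0} -> {set 'I_n0}) Q : {set {set 'I_n0}} :=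
  [set P | fconnect f Q P].

Definition orbit_representatives (f : {set 'I_n0} -> {set 'I_n0})
    (D Omega : {set {set 'I_n0}}) : Prop :=
  Omega \subset D /\ {in D, forall Q, #|Omega :&: fun_orbit f Q| = 1}.

Definition Omega1 (f : {set 'I_n0} -> {set 'I_n0}) (Omega : {set {set 'I_n0}}) :=
  [set Q in Omega | #|fun_orbit f Q| == 1].

Definition Omega2 (f : {set 'I_n0} -> {set 'I_n0}) (Omega : {set {set 'I_n0}}) :=
  [set Q in Omega | 1 < #|fun_orbit f Q|].

(* Computed in an extension L of the base field that contains zeta. *)
Definition class_poly (L : fieldType) (zeta : L) Q : {poly L} :=
  (\prod_(i in Q) ('X - (zeta ^+ i)%:P))%R.

End Cyclotomic.

(* Main.v *)
Require Import Defs.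
From HB Require Import structures.
From mathcomp Require Import all_boot all_algebra.
From mathcomp Require Import cyclic finfield.

Set Implicit Arguments.
Unset Strict Implicit.
Unset Printing Implicit Defensive.

Import GRing.Theory.
Local Open Scope ring_scope.

(** Write [n = n0 * p ^ r] with [p = 2] the characteristic of [F], which does not
    divide [n0].  Over [L] the polynomial ['X^n - 1] is the product of the
    [('X - zeta^i)^(p ^ r)], so a monic divisor [g] of it is the same thing as
    its multiplicities [0 <= root_mult g i <= p ^ r] at the [zeta^i].  These
    are constant on cyclotomic classes because [g] has coefficients in [F]
    ([root_mult_class]), and conversely every choice that is constant on
    classes comes from [F], since the product is then fixed by the Frobenius
    map of [F] ([prod_class_poly_descent]).

    The dual code is computed without reciprocal polynomials.  In
    [F[x]/(x^n - 1)] the inverse of [x] is [x^(n-1)], and the form of [v] and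
    [c] is the constant coefficient of [v(x) * c^theta(x^(n-1))]
    ([galois_formE]).  The map sending a residue to its constant coefficient
    vanishes on no nonzero ideal, whence [v] is orthogonal to the ideal of [g]
    iff ['X^n - 1] divides [v * G], where [G = g^theta(x^(n-1))]
    ([galois_dual_ideal_code]).  The dual is therefore generated by
    ['X^n - 1] divided by its gcd with [G], and self-duality says that
    [g * gcd('X^n - 1, G)] is associate to ['X^n - 1]
    ([galois_self_dual_ideal_code]).

    Multiplicities turn this into arithmetic.  As [x^(n-1)] has nonzero
    derivative at [zeta^j], substituting it does not change multiplicities,
    and neither does the field morphism [theta]; so [G] has at [zeta^j] the
    multiplicity of [g] at [zeta^i], where [j = - q^T i] ([mup_adjoint]).
    Hence the code is self-dual iff the exponents of [g] at the classes [Q]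
    and [sigma Q] always add up to [p ^ r] ([self_dual_root_mult]).

    What remains is about an involution.  The orbits are [{Q, sigma Q}]; on a
    fixed class the exponent must be half of [p ^ r], and on an orbit of size
    two it is free at the representative and determined at the other class.
    This is the announced factorisation ([prod_balanced]).  Since every cyclic
    code has a unique generator polynomial ([cyclic_code_has_generator],
    [ideal_code_inj]), counting the free exponents counts the codes. *)

(** * Power maps in positive characteristic *)

Section PowerMorphism.
Variables (R : comNzRingType) (m : nat).

(** The map is indexed by its exponent, not by the number of iterations of the
    Frobenius map, so that it is convertible to [frob_pow]. *)
Definition pchar_power of [pchar R].-nat m := fun x : R => x ^+ m.

Hypothesis chRm : [pchar R].-nat m.

Fact pchar_power_is_nmod_morphism : nmod_morphism (pchar_power chRm).
Proof.
split=> [|x y]; rewrite /pchar_power ?exprDn_pchar //.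
by have /andP[m_gt0 _] := chRm; rewrite expr0n gtn_eqF.
Qed.

Fact pchar_power_is_monoid_morphism : monoid_morphism (pchar_power chRm).
Proof. by split=> [|x y]; rewrite /pchar_power ?expr1n ?exprMn. Qed.

HB.instance Definition _ := GRing.isNmodMorphism.Build R R
  (pchar_power chRm) pchar_power_is_nmod_morphism.
HB.instance Definition _ := GRing.isMonoidMorphism.Build R R
  (pchar_power chRm) pchar_power_is_monoid_morphism.

End PowerMorphism.

(** * Multiplicities of roots *)

Section RootMultiplicity.
Variable F : fieldType.
Implicit Types (x : F) (p q : {poly F}).

Lemma mup_factor x p : p != 0 ->
  exists2 s, ~~ root s x & p = s * ('X - x%:P) ^+ mup x p.
Proof.
move=> p_neq0; have [m [s]] := multiplicity_XsubC p x.
rewrite p_neq0 /= => sNx pE; exists s => //.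
by rewrite [in mup x p]pE mupMr // mup_XsubCX eqxx.
Qed.

Lemma mup_prod x (I : Type) (r : seq I) (P : pred I) (G : I -> {poly F}) :
    (forall i, P i -> G i != 0) ->
  mup x (\prod_(i <- r | P i) G i) = (\sum_(i <- r | P i) mup x (G i))%N.
Proof.
move=> Gnz; elim: r => [|i r IHr]; first by rewrite !big_nil mupNroot // root1.
rewrite !big_cons; case: ifPn => // Pi; rewrite mupM ?IHr ?Gnz //.
rewrite prodf_seq_neq0; elim: r {IHr} => //= j r ->; rewrite andbT.
exact/implyP/Gnz.
Qed.

Lemma mup_dvdp x p q : q != 0 -> p %| q -> (mup x p <= mup x q)%N.
Proof.
move=> q_neq0 p_dv_q; rewrite mup_geq //; apply: (dvdp_trans _ p_dv_q).
rewrite -mup_geq //; apply: contraNneq q_neq0 => p0.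
by move: p_dv_q; rewrite p0 dvd0p.
Qed.

Lemma mup_eqp x p q : p %= q -> mup x p = mup x q.
Proof.
move=> pq; have [p0|p_neq0] := eqVneq p 0.
  by move: pq; rewrite p0 eqp_sym eqp0 => /eqP->.
have q_neq0 : q != 0 by apply: contraNneq p_neq0 => q0; rewrite -eqp0 -q0.
have /andP[pdq qdp] := pq.
by apply/eqP; rewrite eqn_leq !mup_dvdp.
Qed.

Lemma mup_gcdp x p q : p != 0 -> q != 0 ->
  mup x (gcdp p q) = minn (mup x p) (mup x q).
Proof.
move=> p_neq0 q_neq0; have g_neq0 : gcdp p q != 0.
  by rewrite gcdp_eq0 negb_and p_neq0.
apply/eqP; rewrite eqn_leq leq_min !mup_dvdp ?dvdp_gcdl ?dvdp_gcdr //=.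
by rewrite mup_geq // dvdp_gcd -!mup_geq // geq_minl geq_minr.
Qed.

(** When [q] is unramified at [x], the polynomial [q - q(x)] has a simple root
    at [x], so substituting [q] only moves the roots of [p]. *)
Lemma mup_comp x p q : p != 0 -> q^`().[x] != 0 ->
  mup x (p \Po q) = mup q.[x] p.
Proof.
move=> p_neq0 q'x; set y := q.[x].
have qy_neq0 : q - y%:P != 0.
  apply: contraNneq q'x => /eqP; rewrite subr_eq0 => /eqP->.
  by rewrite derivC horner0.
(* A double root of q - q(x) at x would make the derivative of q vanish there. *)
have mup1 : mup x (q - y%:P) = 1%N.
  apply/eqP; rewrite eqn_leq mup_leq // mup_geq // expr1 dvdp_XsubCl.
  rewrite rootE !hornerE subrr eqxx andbT.
  apply: contraNN q'x => /dvdpP[s] /(congr1 deriv)/(congr1 (horner^~ x)).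
  rewrite derivB derivC subr0 => ->.
  by rewrite expr2 !derivM !hornerE subrr /= !(mulr0, mul0r, addr0).
have [s sNy pE] := mup_factor y p_neq0.
rewrite {1}pE comp_polyM mupMr; last by rewrite rootE horner_comp -rootE.
rewrite rmorphXn /= comp_polyB comp_polyX comp_polyC.
elim: (mup y p) => [|m IHm]; first by rewrite expr0 mupNroot // root1.
by rewrite exprS mupM ?expf_neq0 // IHm mup1.
Qed.

End RootMultiplicity.

Lemma mup_map (F K : fieldType) (f : {rmorphism F -> K}) x (p : {poly F}) :
  p != 0 -> mup (f x) (map_poly f p) = mup x p.
Proof.
move=> p_neq0; have [s sNx pE] := mup_factor x p_neq0.
rewrite {1}pE rmorphM rmorphXn /= map_polyXsubC mupMr ?mup_XsubCX ?eqxx //.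
by rewrite fmorph_root.
Qed.

Section SplitProducts.
Variables (L : fieldType) (I : finType) (z : I -> L).
Hypothesis z_inj : injective z.
Implicit Type e : I -> nat.

Definition root_prod e := \prod_i ('X - (z i)%:P) ^+ e i.

Lemma root_prod_monic e : root_prod e \is monic.
Proof. by apply: monic_prod => i _; rewrite monic_exp ?monicXsubC. Qed.

Lemma mup_root_prod e i : mup (z i) (root_prod e) = e i.
Proof.
rewrite mup_prod; last by move=> j _; rewrite expf_neq0 ?polyXsubC_eq0.
rewrite (bigD1 i) //= mup_XsubCX eqxx big1 ?addn0 // => j ji.
by rewrite mup_XsubCX (inj_eq z_inj) (negPf ji).
Qed.

(** Unique factorisation: a divisor is the product of a subfamily of the linear
    factors, and counting the factors at each [z i] recovers the multiplicity. *)
Lemma dvdp_root_prod e (p : {poly L}) : p \is monic ->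
  p %| root_prod e -> p = root_prod (fun i => mup (z i) p).
Proof.
move=> p_monic p_dv.
have expE (t : seq I) :
    \prod_(i <- t) ('X - (z i)%:P) = root_prod (fun i => count_mem i t).
  rewrite (partition_big id xpredT) //=; apply: eq_bigr => i _.
  rewrite (eq_bigr (fun=> 'X - (z i)%:P)); last by move=> j /eqP->.
  by rewrite big_const_seq iter_mulr_1.
have eE : root_prod e =
    \prod_(i <- flatten [seq nseq (e i) i | i <- enum I]) ('X - (z i)%:P).
  rewrite big_flatten big_map big_enum /=; apply: eq_bigr => i _.
  by rewrite big_nseq iter_mulr_1.
move: p_dv; rewrite eE => /dvdp_prod_XsubC[m].
rewrite expE eqp_monic ?root_prod_monic // => /eqP pE.
by rewrite {1}pE /root_prod; apply: eq_bigr => i _; rewrite pE mup_root_prod.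
Qed.

End SplitProducts.

(** * Cyclic codes as ideals *)

Section CyclicCodes.
Variables (F : finFieldType) (n : nat).
Hypothesis n_gt0 : (0 < n)%N.
Implicit Types (p g : {poly F}) (c v : 'rV[F]_n) (C : {set 'rV[F]_n}).

Local Notation Xn1 := ('X^n - 1 : {poly F}).

Let size_Xn1 : size Xn1 = n.+1.
Proof. by rewrite -[1]/(1%:P) size_XnsubC. Qed.

Let Xn1_neq0 : Xn1 != 0.
Proof. by rewrite -size_poly_eq0 size_Xn1. Qed.

Let size_mod_Xn1 p : (size (p %% Xn1)%R <= n)%N.
Proof. by rewrite -ltnS -size_Xn1 ltn_modp. Qed.

Let mod_rVpoly c : rVpoly c %% Xn1 = rVpoly c.
Proof. by rewrite modp_small // size_Xn1 ltnS size_poly. Qed.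

Definition residue_word p : 'rV[F]_n := poly_rV (p %% Xn1).

Lemma rVpoly_residue_word p : rVpoly (residue_word p) = p %% Xn1.
Proof. by rewrite poly_rV_K. Qed.

Lemma residue_word_rVpoly c : residue_word (rVpoly c) = c.
Proof. by rewrite /residue_word mod_rVpoly rVpolyK. Qed.

Lemma residue_wordD p1 p2 : residue_word (p1 + p2) = residue_word p1 + residue_word p2.
Proof. by rewrite /residue_word modpD raddfD. Qed.

Lemma residue_wordZ a p : residue_word (a *: p) = a *: residue_word p.
Proof. by rewrite /residue_word modpZl linearZ. Qed.

(** The word shifted out at the end of [x * c] comes back in front because
    [x^n = 1]; this is where codes closed under shifts become ideals. *)
Lemma cyclic_shiftE c : cyclic_shift c = residue_word ('X * rVpoly c).
Proof.
have l_lt : (n.-1 < n)%N by rewrite ltn_predL.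
pose l := Ordinal l_lt; rewrite /residue_word.
have -> : 'X * rVpoly c = (c 0 l)%:P * Xn1 + rVpoly (cyclic_shift c).
  apply/polyP=> k; rewrite coefD coefXM mul_polyC coefZ coefB coefXn coef1.
  case: k => [|k] /=.
    rewrite eq_sym gtn_eqF // sub0r mulrN1 (coef_rVpoly_ord _ (Ordinal n_gt0)) mxE.
    apply/eqP; rewrite eq_sym addrC subr_eq0; apply/eqP; congr (c _ _).
    by apply: val_inj; rewrite /= add0n modn_small.
  rewrite subr0; have [kn|nk|kn] := ltngtP k.+1 n.
  - rewrite mulr0 add0r (coef_rVpoly_ord _ (Ordinal kn)).
    rewrite mxE -(coef_rVpoly_ord c); congr (_`_ _).
    by rewrite /= modnDr modn_small // ltnW.
  - by rewrite mulr0 add0r !nth_default // (leq_trans (size_poly _ _)) // ltnW.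
  rewrite mulr1 [X in _ + X]nth_default ?kn ?size_poly // addr0.
  by rewrite -(coef_rVpoly_ord c l); congr (_`_ _); rewrite -[k]/(k.+1.-1) kn.
by rewrite modp_addl_mul_small ?rVpolyK // size_Xn1 ltnS size_poly.
Qed.

Section GeneratorPolynomials.
Variable g : {poly F}.
Hypothesis g_dv : g %| Xn1.

Lemma mem_ideal_code c : (c \in ideal_code n g) = (g %| rVpoly c).
Proof.
apply/imsetP/idP=> [[a _ ->]|/dvdpP[s cE]].
  by rewrite rVpoly_residue_word -dvdp_mod // dvdp_mull.
exists (poly_rV s); rewrite //.
have g_neq0 : g != 0 by apply: contraTneq g_dv => ->; rewrite dvd0p.
rewrite poly_rV_K; first by rewrite -cE -[LHS]residue_word_rVpoly.
have := size_poly n (fun k => if insub k is Some i then c 0 i else 0).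
rewrite -/(rVpoly c) cE; have [->|s_neq0] := eqVneq s 0; first by rewrite size_poly0.
apply: leq_trans; rewrite dvdp_leq ?mulf_neq0 //; exact: dvdp_mulr.
Qed.

Lemma mem_residue_word p : (residue_word p \in ideal_code n g) = (g %| p).
Proof. by rewrite mem_ideal_code rVpoly_residue_word -dvdp_mod. Qed.

Lemma ideal_code_cyclic : cyclic_code (ideal_code n g).
Proof.
apply/andP; split; last first.
  apply/forall_inP=> c; rewrite !mem_ideal_code => g_dv_c.
  by rewrite cyclic_shiftE rVpoly_residue_word -dvdp_mod // dvdp_mull.
apply/andP; split; first by rewrite mem_ideal_code linear0 dvdp0.
apply/forallP=> a; apply/forall_inP=> u; rewrite mem_ideal_code => gu.
apply/forall_inP=> v; rewrite !mem_ideal_code => gv.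
by rewrite linearP /= dvdp_add // -mul_polyC dvdp_mull.
Qed.

End GeneratorPolynomials.

Lemma ideal_code_inj g1 g2 : g1 \is monic -> g2 \is monic ->
  g1 %| Xn1 -> g2 %| Xn1 -> ideal_code n g1 = ideal_code n g2 -> g1 = g2.
Proof.
move=> g1_monic g2_monic g1_dv g2_dv eq12; apply/eqP; rewrite -eqp_monic // /eqp.
rewrite -(mem_residue_word g1_dv) eq12 mem_residue_word // dvdpp /=.
by rewrite -(mem_residue_word g2_dv) -eq12 mem_residue_word ?dvdpp.
Qed.

Lemma cyclic_code_residue_mul C p1 p2 : cyclic_code C ->
  residue_word p2 \in C -> residue_word (p1 * p2) \in C.
Proof.
case/andP=> /andP[C0 /forallP C_lin] /forall_inP C_shift p2C.
elim/poly_ind: p1 => [|q a IHq]; first by rewrite mul0r /residue_word mod0p linear0.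
rewrite mulrDl addrC residue_wordD mul_polyC residue_wordZ.
have /forall_inP/(_ _ p2C)/forall_inP := C_lin a; apply.
have -> : residue_word (q * 'X * p2) = cyclic_shift (residue_word (q * p2)).
  by rewrite cyclic_shiftE rVpoly_residue_word /residue_word modp_mul mulrAC mulrC.
exact: C_shift.
Qed.

Lemma cyclic_code_residueD C p1 p2 : cyclic_code C ->
  residue_word p1 \in C -> residue_word p2 \in C -> residue_word (p1 + p2) \in C.
Proof.
case/andP=> /andP[_ /forallP C_lin] _ p1C p2C; rewrite residue_wordD.
by have /forall_inP/(_ _ p1C)/forall_inP/(_ _ p2C) := C_lin 1; rewrite scale1r.
Qed.

(** Starting from ['X^n - 1], replace the current divisor by its gcd with a
    codeword that it does not divide; by Bezout the gcd stays in the code, and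
    its degree drops, so the process ends at a divisor of all codewords. *)
Lemma cyclic_code_has_generator C : cyclic_code C -> exists g, generator_poly C g.
Proof.
move=> C_cyc.
have [p p_dv [pC p_min]] : exists2 p, p %| Xn1 &
    residue_word p \in C /\ {in C, forall c, p %| rVpoly c}.
  have [m] := ubnP (size Xn1).
  have: residue_word Xn1 \in C.
    rewrite /residue_word modpp linear0.
    by case/andP: C_cyc => /andP[].
  move: (dvdpp Xn1); move: {1 3 4}Xn1 => p.
  elim: m p => // m IHm p p_dv pC; rewrite ltnS => p_le.
  have [/forall_inP p_min|] := boolP [forall c in C, p %| rVpoly c].
    by exists p.
  rewrite negb_forall => /existsP[c]; rewrite negb_imply => /andP[cC pNc].
  have p_neq0 : p != 0 by apply: contraTneq p_dv => ->; rewrite dvd0p.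
  apply: (IHm (gcdp p (rVpoly c))).
  - by apply: dvdp_trans p_dv; apply: dvdp_gcdl.
  - have [[u v] /= /eqpP[[a b] /= /andP[a0 b0] abE]] := Bezoutp p (rVpoly c).
    have -> : gcdp p (rVpoly c) = (b^-1 * a) %:P * u * p + (b^-1 * a)%:P * v * rVpoly c.
      rewrite -!mulrA -mulrDr mul_polyC -scalerA abE scalerA mulVf // scale1r //.
    apply: cyclic_code_residueD => //; apply: cyclic_code_residue_mul => //.
    by rewrite residue_word_rVpoly.
  apply: leq_trans p_le; rewrite ltn_neqAle dvdp_leq ?dvdp_gcdl // andbT.
  apply: contraNneq pNc => /eqP; rewrite dvdp_size_eqp ?dvdp_gcdl // => gp.
  by rewrite -(eqp_dvdl _ gp) dvdp_gcdr.
have p_neq0 : p != 0 by apply: contraTneq p_dv => ->; rewrite dvd0p.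
pose g := (lead_coef p)^-1 *: p.
have gp : g %= p by rewrite eqp_scale // invr_eq0 lead_coef_eq0.
have g_dv : g %| Xn1 by rewrite (eqp_dvdl _ gp).
exists g; split=> //.
  by rewrite monicE lead_coefZ mulVf // lead_coef_eq0.
apply/setP=> c; rewrite mem_ideal_code // (eqp_dvdl _ gp).
apply/idP/idP=> [|/dvdpP[s cE]]; first exact: p_min.
by rewrite -[c]residue_word_rVpoly cE cyclic_code_residue_mul.
Qed.

(** * The dual of a cyclic code *)

Section Duality.
Variable theta : {rmorphism F -> F}.

(** In [F[x]/(x^n - 1)] this is [p^theta(x^-1)]: multiplication by
    [adjoint p] is adjoint to multiplication by [p] for [galois_form theta]. *)
Definition adjoint p : {poly F} := map_poly theta p \Po 'X^(n.-1).

Lemma adjointD p1 p2 : adjoint (p1 + p2) = adjoint p1 + adjoint p2.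
Proof. by rewrite /adjoint !rmorphD. Qed.

Lemma adjointM p1 p2 : adjoint (p1 * p2) = adjoint p1 * adjoint p2.
Proof. by rewrite /adjoint !rmorphM. Qed.

Lemma adjointXn m : adjoint 'X^m = 'X^(n.-1 * m).
Proof. by rewrite /adjoint map_polyXn comp_Xn_poly exprM. Qed.

Lemma Xn1_dvdp m : Xn1 %| 'X^(n * m) - 1.
Proof. by rewrite exprM [X in _ %| X]subrX1 dvdp_mulr. Qed.

Lemma Xn1_dvdp_adjoint p : Xn1 %| p -> Xn1 %| adjoint p.
Proof.
case/dvdpP=> s ->; rewrite adjointM dvdp_mull // /adjoint rmorphB /=.
by rewrite map_polyXn rmorph1 rmorphB /= comp_Xn_poly rmorph1 -exprM mulnC Xn1_dvdp.
Qed.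

Definition residue_const p : F := (p %% Xn1)`_0.

Lemma residue_const_eq0 p : Xn1 %| p -> residue_const p = 0.
Proof. by rewrite /residue_const => /modp_eq0->; rewrite coef0. Qed.

Lemma residue_constD p1 p2 :
  residue_const (p1 + p2) = residue_const p1 + residue_const p2.
Proof. by rewrite /residue_const modpD coefD. Qed.

Lemma residue_constZ a p : residue_const (a *: p) = a * residue_const p.
Proof. by rewrite /residue_const modpZl coefZ. Qed.

Lemma residue_const0 : residue_const 0 = 0.
Proof. by rewrite residue_const_eq0 ?dvdp0. Qed.

Lemma residue_const_sum (I : Type) (r : seq I) (G : I -> {poly F}) :
  residue_const (\sum_(i <- r) G i) = \sum_(i <- r) residue_const (G i).
Proof. exact: (big_morph _ residue_constD residue_const0). Qed.

Lemma residue_constXn m : residue_const 'X^m = (n %| m)%:R.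
Proof.
rewrite /residue_const {1}(divn_eq m n) mulnC exprD.
rewrite -[X in X * _](subrK 1) mulrDl mul1r modpD modp_eq0 ?dvdp_mulr ?Xn1_dvdp //.
rewrite add0r modp_small ?coefXn; first by rewrite eq_sym.
by rewrite size_Xn1 size_polyXn !ltnS ltn_mod.
Qed.

(** The other coefficients of a residue are constant coefficients of its shifts,
    [x^(n-1)] being the inverse of [x].  Hence a residue all of whose multiples
    have constant coefficient zero is zero. *)
Lemma residue_const_coef p (s : 'I_n) :
  residue_const (p * 'X^(n.-1 * s)) = (p %% Xn1)`_s.
Proof.
rewrite {1}(divp_eq p Xn1) mulrDl residue_constD.
rewrite residue_const_eq0 ?add0r; last by rewrite dvdp_mulr ?dvdp_mull.
set w := p %% Xn1; have -> : w = rVpoly (residue_word p).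
  by rewrite rVpoly_residue_word.
rewrite {1}[residue_word p]row_sum_delta linear_sum mulr_suml residue_const_sum.
rewrite (bigD1 s) //= linearZ /= rVpoly_delta -scalerAl -exprD residue_constZ.
rewrite residue_constXn -mulSn prednK // dvdn_mulr // mulr1 coef_rVpoly_ord.
rewrite big1 ?addr0 // => i is_; rewrite linearZ /= rVpoly_delta -scalerAl.
rewrite -exprD residue_constZ residue_constXn.
rewrite (_ : (n %| _)%N = false) ?mulr0 //; apply: contraNF is_ => n_dv.
have: (i + n.-1 * s + s == 0 + s %[mod n])%N by rewrite eqn_modDr mod0n.
rewrite -addnA -mulSnr prednK // add0n addnC mulnC modnMDl !modn_small //.
Qed.

Lemma galois_formE v c :
  galois_form theta v c = residue_const (rVpoly v * adjoint (rVpoly c)).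
Proof.
have adjE : adjoint (rVpoly c) = \sum_(i < n) theta (c 0 i) *: 'X^(n.-1 * i).
  rewrite {1}[c]row_sum_delta /adjoint linear_sum /= !rmorph_sum /=.
  apply: eq_bigr => i _; rewrite linearZ /= rVpoly_delta map_polyZ map_polyXn.
  by rewrite comp_polyZ comp_Xn_poly -exprM.
rewrite adjE mulr_sumr residue_const_sum; apply: eq_bigr => i _.
rewrite -scalerAr residue_constZ residue_const_coef mod_rVpoly coef_rVpoly_ord.
exact: mulrC.
Qed.

(** Orthogonality to all shifts of [g] kills every coefficient of the residue of
    [v * adjoint g], not only the constant one. *)
Lemma galois_dual_ideal_code g v : g %| Xn1 ->
  (v \in galois_dual theta (ideal_code n g)) = (Xn1 %| rVpoly v * adjoint g).
Proof.
move=> g_dv; rewrite inE; apply/forall_inP/idP=> [v_dual | v_adj c].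
  apply/modp_eq0P/polyP=> s; rewrite coef0.
  have [s_lt|s_ge] := ltnP s n; last by rewrite nth_default // (leq_trans _ s_ge).
  rewrite -(residue_const_coef _ (Ordinal s_lt)) /= -adjointXn -mulrA -adjointM.
  have /v_dual/eqP : residue_word (g * 'X^s) \in ideal_code n g.
    by rewrite mem_residue_word // dvdp_mulr.
  rewrite galois_formE rVpoly_residue_word => form0.
  rewrite [g * _](divp_eq _ Xn1) adjointD mulrDr residue_constD form0 addr0.
  by rewrite residue_const_eq0 // dvdp_mull // Xn1_dvdp_adjoint // dvdp_mull.
rewrite mem_ideal_code // => /dvdpP[s cE].
by rewrite galois_formE cE adjointM mulrCA residue_const_eq0 // dvdp_mull.
Qed.

(** The annihilator of [adjoint g] modulo ['X^n - 1] is generated by the cofactor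
    of the gcd, and the code equals its dual iff [g] is that cofactor. *)
Lemma galois_self_dual_ideal_code g : g %| Xn1 ->
  galois_self_dual theta (ideal_code n g) = (g * gcdp Xn1 (adjoint g) %= Xn1).
Proof.
move=> g_dv; set d := gcdp _ _.
have d_neq0 : d != 0 by rewrite gcdp_eq0 negb_and Xn1_neq0.
set h := Xn1 %/ d; have hE : Xn1 = h * d by rewrite divpK ?dvdp_gcdl.
have annE p : (Xn1 %| p * adjoint g) = (h %| p).
  have aE : adjoint g = (adjoint g %/ d) * d by rewrite divpK ?dvdp_gcdr.
  rewrite {1}hE {1}aE mulrA dvdp_mul2r // Gauss_dvdpl //.
  by rewrite coprimep_div_gcd // Xn1_neq0.
rewrite [X in _ %= X]hE eqp_mul2r //; apply/eqP/idP=> [C_dual|/eqp_dvdl gh].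
  have gh p : (g %| p) = (h %| p).
    rewrite -mem_residue_word // C_dual galois_dual_ideal_code // annE.
    by rewrite rVpoly_residue_word -dvdp_mod // hE dvdp_mulr.
  by rewrite /eqp gh dvdpp -gh dvdpp.
by apply/setP=> v; rewrite galois_dual_ideal_code // annE mem_ideal_code // gh.
Qed.

End Duality.

End CyclicCodes.

(** * Cyclotomic classes *)

Section Cyclotomic.
Variables (n0 s : nat).
Hypotheses (n0_gt0 : (0 < n0)%N) (s_coprime : coprime s n0).
Implicit Types (i j : 'I_n0) (Q : {set 'I_n0}).

Local Notation cclass := (@cyclotomic_class n0 s).
Local Notation classes := (cyclotomic_classes n0 s).

Lemma dvdn_opp_mul_surj m j : coprime m n0 -> exists i, (n0 %| j + m * i)%N.
Proof.
move=> m_coprime; set x := (m ^ (totient n0).-1 * (n0.-1 * j))%N.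
exists (Ordinal (ltn_pmod x n0_gt0)).
rewrite /dvdn /= -modnDmr modnMmr modnDmr mulnA -expnS.
rewrite prednK ?totient_gt0 // -modnDmr -modnMml Euler_exp_totient //.
by rewrite modnMml modnDmr mul1n -mulSn prednK // modnMr.
Qed.

Lemma dvdn_opp_mul_total m i : exists j, (n0 %| j + m * i)%N.
Proof.
exists (Ordinal (ltn_pmod (n0.-1 * (m * i)) n0_gt0)).
by rewrite /dvdn /= modnDml -mulSnr prednK // modnMr.
Qed.

Lemma cyclotomic_class_refl i : i \in cclass i.
Proof. by rewrite inE connect0. Qed.

(** Multiplication by [s] is invertible modulo [n0], with inverse a power of [s]
    by Euler's theorem, so going forward reaches everything behind. *)
Lemma cyclotomic_class_sym i j : (j \in cclass i) = (i \in cclass j).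
Proof.
suff sub i1 j1 : j1 \in cclass i1 -> i1 \in cclass j1 by apply/idP/idP; apply: sub.
case/cyclotomic_classP=> t jE; apply/cyclotomic_classP.
exists (totient n0 * t - t)%N; rewrite jE modnMmr mulnA -expnD subnK; last first.
  by rewrite leq_pmull ?totient_gt0.
rewrite expnM -modnMml -modnXm Euler_exp_totient //.
by rewrite modnXm exp1n modnMml mul1n modn_small.
Qed.

Lemma cyclotomic_class_eq i j : (cclass i == cclass j) = (i \in cclass j).
Proof.
apply/eqP/idP=> [<-|ij]; first exact: cyclotomic_class_refl.
have trans x y z : y \in cclass x -> z \in cclass y -> z \in cclass x.
  by rewrite !inE; apply: connect_trans.
have ji : j \in cclass i by rewrite cyclotomic_class_sym.
by apply/setP=> x; apply/idP/idP; apply: trans.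
Qed.

Lemma mem_cyclotomic_classes i : cclass i \in classes.
Proof. exact: imset_f. Qed.

Lemma opp_mul_class_cyclotomic m i j : coprime m n0 -> (n0 %| j + m * i)%N ->
  opp_mul_class m (cclass i) = cclass j.
Proof.
move=> m_coprime n0_dv.
have shift t : (s ^ t * j + m * (s ^ t * i) = 0 %[mod n0])%N.
  by rewrite mulnCA -mulnDr mod0n; apply/eqP; rewrite -/(dvdn _ _) dvdn_mull.
apply/setP=> x; rewrite inE; apply/exists_inP/cyclotomic_classP.
  case=> y /cyclotomic_classP[t yE] x_dv; exists t.
  rewrite -[LHS](modn_small (ltn_ord x)).
  apply/eqP; rewrite -(eqn_modDr (m * (s ^ t * i))) shift mod0n.
  by rewrite -modnDmr -modnMmr -yE modnDmr.
case=> t xE; exists (Ordinal (ltn_pmod (s ^ t * i) n0_gt0)).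
  by apply/cyclotomic_classP; exists t.
by rewrite /dvdn /= xE modnDml -modnDmr modnMmr modnDmr shift mod0n.
Qed.

Lemma opp_mul_class_in m : coprime m n0 ->
  {in classes, forall Q, opp_mul_class m Q \in classes}.
Proof.
move=> m_coprime _ /imsetP[i _ ->]; have [j n0_dv] := dvdn_opp_mul_total m i.
by rewrite (opp_mul_class_cyclotomic m_coprime n0_dv) mem_cyclotomic_classes.
Qed.

Definition mul_ord i : 'I_n0 := Ordinal (ltn_pmod (s * i) n0_gt0).

Lemma mul_ord_inj : injective mul_ord.
Proof.
have mulK i : ((s ^ (totient n0).-1 * mul_ord i) %% n0)%N = i.
  rewrite modnMmr mulnA -expnSr prednK ?totient_gt0 // -modnMml.
  by rewrite Euler_exp_totient // modnMml mul1n modn_small.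
by move=> i j ij; apply: val_inj; rewrite /= -mulK ij mulK.
Qed.

Lemma cyclotomic_class_mul_ord i : cclass (mul_ord i) = cclass i.
Proof.
apply/eqP; rewrite cyclotomic_class_eq; apply/cyclotomic_classP.
by exists 1%N; rewrite expn1.
Qed.

Lemma cyclotomic_class_invariant (T : eqType) (e : 'I_n0 -> T) :
  (forall i, e (mul_ord i) = e i) -> forall i j, j \in cclass i -> e j = e i.
Proof.
move=> e_mul i j; rewrite inE => /connectP[w]; elim: w i => [|x w IHw] i /=.
  by move=> _ ->.
case/andP=> /eqP xE wp jE; rewrite (IHw x) //.
rewrite -(e_mul i); congr e; apply: val_inj => /=.
by rewrite -xE modn_small.
Qed.

End Cyclotomic.

(** The condition on exponents that characterises self-dual generators, for [D]
    the set of cyclotomic classes. *)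
Definition balanced (T : finType) (D : {set T}) (sigma : T -> T) (N : nat)
    (E : T -> nat) :=
  {in D, forall Q, (E Q + E (sigma Q) = N)%N}.

(** * Generator polynomials and their exponents *)

Section RootsOfUnity.
Variables (p n0 r : nat) (F : finFieldType) (L : fieldType).
Variables (iota : {rmorphism F -> L}) (zeta : L).
Hypotheses (chF : p \in [pchar F]) (r_gt0 : (0 < r)%N).
Hypothesis zeta_prim : n0.-primitive_root zeta.
Implicit Types (g : {poly F}) (i j : 'I_n0) (Q : {set 'I_n0}) (e : 'I_n0 -> nat).

Local Notation n := (n0 * p ^ r)%N.
Local Notation "g ^iota" := (map_poly iota g) (at level 2, format "g ^iota").

Let n0_gt0 : (0 < n0)%N := prim_order_gt0 zeta_prim.
Let p_prime : prime p := pcharf_prime chF.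
Let n_gt0 : (0 < n)%N.
Proof. by rewrite muln_gt0 n0_gt0 expn_gt0 prime_gt0. Qed.
Let chL : p \in [pchar L].
Proof. exact: rmorph_pchar chF. Qed.

Lemma pchar_pnat (R : nzRingType) m : p \in [pchar R] -> p.-nat m -> [pchar R].-nat m.
Proof. by move=> chR; apply: sub_in_pnat => x _ /eqP->. Qed.

Let zeta_neq0 : zeta != 0.
Proof.
apply: contra_eq_neq (prim_expr_order zeta_prim) => ->.
by rewrite expr0n gtn_eqF // eq_sym oner_eq0.
Qed.

Definition zeta_pow i : L := zeta ^+ i.

Lemma zeta_pow_inj : injective zeta_pow.
Proof.
move=> i j /eqP; rewrite (eq_prim_root_expr zeta_prim) !modn_small // => /eqP.
exact: val_inj.
Qed.

Lemma Xn_sub1_root_prod : 'X^n - 1 = root_prod zeta_pow (fun=> (p ^ r)%N).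
Proof.
rewrite /root_prod prodrXl -(big_mkord xpredT (fun k : nat => 'X - (zeta ^+ k)%:P)).
rewrite (factor_Xn_sub_1 zeta_prim).
have chp : [pchar {poly L}].-nat (p ^ r)%N.
  by apply: pchar_pnat; rewrite ?pnatX ?pnat_id // pchar_poly.
rewrite -[RHS]/(pchar_power chp ('X^n0 - 1)) rmorphB rmorph1 /=.
by rewrite /pchar_power -exprM.
Qed.

Let Xn1_neq0 : 'X^n - 1 != 0 :> {poly L}.
Proof. by rewrite Xn_sub1_root_prod monic_neq0 ?root_prod_monic. Qed.

Let map_Xn1 : ('X^n - 1)^iota = 'X^n - 1.
Proof. by rewrite rmorphB rmorph1 /= map_polyXn. Qed.

Definition root_mult g i : nat := mup (zeta_pow i) g^iota.

Lemma root_mult_le g i : g %| 'X^n - 1 -> (root_mult g i <= p ^ r)%N.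
Proof.
rewrite -(dvdp_map iota) map_Xn1 => g_dv.
rewrite -[X in (_ <= X)%N](mup_root_prod zeta_pow_inj (fun=> (p ^ r)%N) i).
by rewrite -Xn_sub1_root_prod mup_dvdp.
Qed.

Lemma generator_root_prod g : g \is monic -> g %| 'X^n - 1 ->
  g^iota = root_prod zeta_pow (root_mult g).
Proof.
move=> g_monic; rewrite -(dvdp_map iota) map_Xn1 Xn_sub1_root_prod.
by apply: dvdp_root_prod; rewrite ?map_monic //; apply: zeta_pow_inj.
Qed.

(** Both operations in [adjoint] preserve multiplicities: [theta] because it
    extends to a morphism of [L], and the substitution of [x^(n-1)] because
    [n - 1 = -1] in [L], so that its derivative is nonzero at [zeta^j].  The
    point [zeta^j] is sent to [zeta^-j = theta(zeta^i)]. *)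
Lemma mup_adjoint m (chm : [pchar F].-nat m) g i j : g != 0 -> (n0 %| j + m * i)%N ->
  mup (zeta_pow j) (adjoint n (pchar_power chm) g)^iota = root_mult g i.
Proof.
move=> g_neq0 n0_dv.
have chLm : [pchar L].-nat m by rewrite (eq_pnat _ (fmorph_pchar iota)).
have swap : (map_poly (pchar_power chm) g)^iota = map_poly (pchar_power chLm) g^iota.
  rewrite -!map_poly_comp; apply: eq_map_poly => a /=.
  by rewrite /pchar_power rmorphXn.
have gL_neq0 : g^iota != 0 by rewrite map_poly_eq0.
have predn_eqN1 : (n.-1)%:R = -1 :> L.
  apply/eqP; rewrite -addr_eq0 natr1 prednK // natrM natrX (pcharf0 chL).
  by rewrite expr0n gtn_eqF // mulr0.
rewrite /adjoint map_comp_poly swap map_polyXn mup_comp ?map_poly_eq0 //; last first.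
  rewrite derivXn hornerMn hornerXn -mulr_natr predn_eqN1 mulrN1 oppr_eq0.
  by rewrite !expf_neq0.
have rootE : zeta_pow j ^+ n.-1 = pchar_power chLm (zeta_pow i).
  apply: (mulIf (expf_neq0 j zeta_neq0)); rewrite /pchar_power -exprSr prednK //.
  transitivity (1 : L); rewrite /zeta_pow -?exprM -?exprD.
    by rewrite mulnCA exprM (prim_expr_order zeta_prim) expr1n.
  by apply/esym/eqP; rewrite -(prim_order_dvd zeta_prim) addnC mulnC.
by rewrite hornerXn rootE mup_map.
Qed.

Lemma pnat_coprime_order m : p.-nat m -> coprime m n0.
Proof.
move=> pm; apply: (pnat_coprime pm); rewrite p'natE // (dvdn_pcharf chL).
exact: prim_root_natf_neq0 zeta_prim.
Qed.

(** The multiplicity at [zeta^j] of [g * gcd('X^n - 1, adjoint g)] is the sum of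
    those of [g] at [zeta^j] and at [zeta^i], the second being at most [p ^ r]
    already; comparison with ['X^n - 1] gives the criterion. *)
Lemma self_dual_root_mult m (chm : [pchar F].-nat m) g :
    g \is monic -> g %| 'X^n - 1 ->
  reflect (forall i j, (n0 %| j + m * i)%N -> (root_mult g i + root_mult g j = p ^ r)%N)
          (galois_self_dual (pchar_power chm) (ideal_code n g)).
Proof.
move=> g_monic g_dv; have m_coprime : coprime m n0.
  by apply: pnat_coprime_order; rewrite -(eq_pnat _ (pcharf_eq chF)).
rewrite galois_self_dual_ideal_code //.
have g_neq0 := monic_neq0 g_monic.
set a := adjoint n _ g.
have a_neq0 : a^iota != 0.
  rewrite map_poly_eq0 /a /adjoint comp_poly_eq0 ?map_poly_eq0 //.
  rewrite size_polyXn -subn1 ltnS subn_gt0 (leq_trans (prime_gt1 p_prime)) //.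
  apply: leq_trans (leq_pmull _ n0_gt0).
  by rewrite -[X in (X <= _)%N]expn1 leq_pexp2l // prime_gt0.
rewrite -(eqp_map iota) rmorphM /= gcdp_map map_Xn1.
set d := gcdp _ a^iota.
have d_dv : d %| 'X^n - 1 by exact: dvdp_gcdl.
have d_neq0 : d != 0 by apply: contraTneq d_dv => ->; rewrite dvd0p.
have mup_d i j : (n0 %| j + m * i)%N -> mup (zeta_pow j) d = root_mult g i.
  move=> n0_dv; rewrite mup_gcdp // (mup_adjoint _ g_neq0 n0_dv).
  rewrite Xn_sub1_root_prod mup_root_prod; last exact: zeta_pow_inj.
  by apply/minn_idPr/root_mult_le.
apply: (iffP idP) => [gd i j n0_dv|mult_sum].
  have := mup_eqp (zeta_pow j) gd.
  rewrite mupM ?map_poly_eq0 // (mup_d i) // Xn_sub1_root_prod.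
  by rewrite mup_root_prod 1?addnC //; apply: zeta_pow_inj.
(* The gcd is only defined up to a unit; c is its monic associate. *)
pose c := (lead_coef d)^-1 *: d.
have cd : c %= d by rewrite eqp_scale // invr_eq0 lead_coef_eq0.
have c_monic : c \is monic by rewrite monicE lead_coefZ mulVf // lead_coef_eq0.
have cE : c = root_prod zeta_pow (fun i => mup (zeta_pow i) d).
  rewrite [LHS](dvdp_root_prod zeta_pow_inj (e := fun=> (p ^ r)%N)) //; last first.
    by rewrite -Xn_sub1_root_prod (eqp_dvdl _ cd).
  by apply: eq_bigr => i _; rewrite (mup_eqp _ cd).
have /eqp_trans -> // : g^iota * d %= g^iota * c by rewrite eqp_mull // eqp_sym.
rewrite generator_root_prod // cE -big_split Xn_sub1_root_prod /=.
suff -> : root_prod zeta_pow (fun=> (p ^ r)%N) =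
  \prod_i (('X - (zeta_pow i)%:P) ^+ root_mult g i *
           ('X - (zeta_pow i)%:P) ^+ mup (zeta_pow i) d) by rewrite eqpxx.
apply: eq_bigr => j _; have [i n0_dv] := dvdn_opp_mul_surj n0_gt0 j m_coprime.
by rewrite -exprD (mup_d i) // addnC mult_sum.
Qed.

Hypothesis cardF_pnat : p.-nat #|F|.

Let cardF_coprime : coprime #|F| n0 := pnat_coprime_order cardF_pnat.
Let cardF_chL : [pchar L].-nat #|F| := pchar_pnat chL cardF_pnat.

Local Notation cclass := (@cyclotomic_class n0 #|F|).
Local Notation classes := (cyclotomic_classes n0 #|F|).
Local Notation mul_ord := (mul_ord #|F| n0_gt0).
Local Notation phi := (pchar_power cardF_chL).

Lemma zeta_pow_mul_ord i : zeta_pow (mul_ord i) = phi (zeta_pow i).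
Proof. by rewrite /zeta_pow /= (prim_expr_mod zeta_prim) mulnC exprM. Qed.

(** [phi] fixes the coefficients of [g] and sends [zeta^i] to [zeta^(#|F| i)]. *)
Lemma root_mult_class g i j : g != 0 -> j \in cclass i -> root_mult g j = root_mult g i.
Proof.
move=> g_neq0; apply: cyclotomic_class_invariant => {}i.
rewrite /root_mult zeta_pow_mul_ord.
have gE : map_poly phi g^iota = g^iota.
  rewrite -map_poly_comp; apply: eq_map_poly => a /=.
  by rewrite /pchar_power -rmorphXn expf_card.
by rewrite -{1}gE mup_map // map_poly_eq0.
Qed.

Lemma prod_class_poly (E : {set 'I_n0} -> nat) :
  \prod_(Q in classes) class_poly zeta Q ^+ E Q = root_prod zeta_pow (E \o cclass).
Proof.
rewrite /root_prod [RHS](partition_big cclass (mem classes)) /=; last first.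
  by move=> i _; apply: mem_cyclotomic_classes.
apply: eq_bigr => _ /imsetP[j _ ->]; rewrite /class_poly -prodrXl.
apply: eq_big => [i|i]; first by rewrite cyclotomic_class_eq.
by rewrite -cyclotomic_class_eq // => /eqP->.
Qed.

(** The elements of [F] already exhaust the roots of ['X^#|F| - 'X]. *)
Lemma expr_card_iota (x : L) : x ^+ #|F| = x -> exists a, iota a = x.
Proof.
move=> xE; have /(congr1 (fun f => f^iota.[x])) := finField_genPoly F.
rewrite rmorphB /= map_polyXn map_polyX !hornerE xE subrr rmorph_prod horner_prod.
move/esym/eqP/prodf_eq0=> [a _].
by rewrite /= map_polyXsubC hornerXsubC subr_eq0 => /eqP->; exists a.
Qed.

(** [phi] permutes the linear factors inside each class, hence fixes the product,
    whose coefficients are then in [F]. *)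
Lemma prod_class_poly_descent (E : {set 'I_n0} -> nat) :
  {g : {poly F} | g^iota = \prod_(Q in classes) class_poly zeta Q ^+ E Q}.
Proof.
apply: sig_eqW; rewrite prod_class_poly; set f := root_prod _ _.
have f_fix : map_poly phi f = f.
  rewrite /f /root_prod rmorph_prod /= [RHS](reindex_inj (mul_ord_inj cardF_coprime)) /=.
  apply: eq_bigr => i _; rewrite rmorphXn /= map_polyXsubC /= -zeta_pow_mul_ord.
  by rewrite cyclotomic_class_mul_ord.
have /fin_all_exists[a aE] (k : 'I_(size f)) : exists a, iota a = f`_k.
  by apply: expr_card_iota; have /(congr1 (coefp k)) := f_fix; rewrite /= coef_map.
exists (\poly_(k < size f) (if insub k is Some i then a i else 0)).
apply/polyP=> k; rewrite coef_map coef_poly; case: ltnP => [k_lt|k_ge].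
  by rewrite insubT /= aE.
by rewrite /= rmorph0 nth_default.
Qed.

Section SelfDual.
Variable m : nat.
Hypothesis chm : [pchar F].-nat m.
Local Notation sigma := (@opp_mul_class n0 m).

Let m_coprime : coprime m n0.
Proof. by apply: pnat_coprime_order; rewrite -(eq_pnat _ (pcharf_eq chF)). Qed.

Lemma balanced_generator E g : balanced classes sigma (p ^ r) E ->
    g^iota = \prod_(Q in classes) class_poly zeta Q ^+ E Q ->
  [/\ g \is monic, g %| 'X^n - 1 &
      galois_self_dual (pchar_power chm) (ideal_code n g)].
Proof.
rewrite prod_class_poly => E_bal gE.
have g_monic : g \is monic by rewrite -(map_monic iota) gE root_prod_monic.
have g_dv : g %| 'X^n - 1.
  rewrite -(dvdp_map iota) map_Xn1 gE Xn_sub1_root_prod.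
  apply: (big_ind2 (fun u v => u %| v)) => [|u1 v1 u2 v2|i _]; rewrite ?dvdpp //.
    exact: dvdp_mul.
  by rewrite dvdp_exp2l // -(E_bal (cclass i)) ?leq_addr // mem_cyclotomic_classes.
split=> //; apply/self_dual_root_mult => // i j n0_dv.
have multE k : root_mult g k = E (cclass k).
  by rewrite /root_mult gE mup_root_prod //; apply: zeta_pow_inj.
rewrite !multE -(opp_mul_class_cyclotomic #|F| n0_gt0 m_coprime n0_dv).
by rewrite E_bal // mem_cyclotomic_classes.
Qed.

Lemma self_dual_balanced g : g \is monic -> g %| 'X^n - 1 ->
    galois_self_dual (pchar_power chm) (ideal_code n g) ->
  exists2 E, balanced classes sigma (p ^ r) E &
    g^iota = \prod_(Q in classes) class_poly zeta Q ^+ E Q.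
Proof.
move=> g_monic g_dv /self_dual_root_mult g_sd.
pose E Q := if [pick i in Q] is Some i then root_mult g i else 0%N.
have EE i : E (cclass i) = root_mult g i.
  rewrite /E; case: pickP => [j /root_mult_class->|/(_ i)]; rewrite ?monic_neq0 //.
  by rewrite cyclotomic_class_refl.
exists E => [_ /imsetP[i _ ->]|]; last first.
  rewrite prod_class_poly generator_root_prod //.
  by apply: eq_bigr => i _; rewrite /= EE.
have [j n0_dv] := dvdn_opp_mul_total n0_gt0 m i.
rewrite (opp_mul_class_cyclotomic #|F| n0_gt0 m_coprime n0_dv) !EE.
exact: g_sd n0_dv.
Qed.

Lemma prod_class_poly_inj E1 E2 :
    \prod_(Q in classes) class_poly zeta Q ^+ E1 Q =
      \prod_(Q in classes) class_poly zeta Q ^+ E2 Q ->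
  {in classes, E1 =1 E2}.
Proof.
rewrite !prod_class_poly => E12 _ /imsetP[i _ ->].
have := congr1 (mup (zeta_pow i)) E12.
by rewrite !mup_root_prod //; apply: zeta_pow_inj.
Qed.

End SelfDual.

End RootsOfUnity.

(** * Orbits of an involution *)

Section InvolutionOrbits.
Variables (n0 : nat) (sigma : {set 'I_n0} -> {set 'I_n0}).
Variables D Omega : {set {set 'I_n0}}.
Hypothesis sigma_in : {in D, forall Q, sigma Q \in D}.
Hypothesis sigmaK : {in D, forall Q, sigma (sigma Q) = Q}.
Hypothesis Omega_repr : orbit_representatives sigma D Omega.
Implicit Types (Q : {set 'I_n0}) (b E : {set 'I_n0} -> nat).

Lemma fun_orbit_involution Q : Q \in D -> fun_orbit sigma Q = [set Q; sigma Q].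
Proof.
move=> QD; apply/setP=> P; rewrite !inE; apply/idP/orP=> [/iter_findex <-|].
  elim: (findex _ _ _) => [|t IHt]; first by left.
  by rewrite iterS; case: IHt => /eqP->; rewrite ?sigmaK //; [right|left].
case=> /eqP->; [exact: connect0 | exact: (fconnect_iter sigma 1)].
Qed.

Lemma Omega_sub Q : Q \in Omega -> Q \in D.
Proof. by case: Omega_repr => /subsetP sub _; apply: sub. Qed.

Lemma Omega1E Q : (Q \in Omega1 sigma Omega) = (Q \in Omega) && (sigma Q == Q).
Proof.
rewrite inE; case: (boolP (Q \in Omega)) => // /Omega_sub QD /=.
by rewrite fun_orbit_involution // cards2 [sigma Q == _]eq_sym; case: (Q == _).
Qed.

Lemma Omega2E Q : (Q \in Omega2 sigma Omega) = (Q \in Omega) && (sigma Q != Q).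
Proof.
rewrite inE; case: (boolP (Q \in Omega)) => // /Omega_sub QD /=.
by rewrite fun_orbit_involution // cards2 [sigma Q == _]eq_sym; case: (Q == _).
Qed.

Lemma card_orbit_Omega2 Q : Q \in Omega2 sigma Omega -> #|fun_orbit sigma Q| = 2%N.
Proof.
rewrite Omega2E => /andP[/Omega_sub QD sQ].
by rewrite fun_orbit_involution // cards2 [Q == _]eq_sym sQ.
Qed.

Lemma Omega_fixed Q : Q \in D -> sigma Q = Q -> Q \in Omega.
Proof.
move=> QD sQ; case: Omega_repr => _ /(_ Q QD).
rewrite fun_orbit_involution // sQ setUid; apply: contra_eqT => QN.
rewrite (_ : _ :&: _ = set0) ?cards0 //; apply/eqP.
by rewrite setI_eq0 disjoint_sym disjoints1.
Qed.

Lemma Omega_sigma Q : Q \in D -> sigma Q != Q -> (sigma Q \in Omega) = (Q \notin Omega).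
Proof.
move=> QD sQ; case: Omega_repr => _ /(_ Q QD).
rewrite fun_orbit_involution // setIUr cardsU.
rewrite (_ : _ :&: _ :&: _ = set0); last first.
  apply/setP=> P; rewrite !inE; apply/negP.
  by case/andP=> /andP[_ /eqP->] /andP[_ /eqP QsQ]; rewrite -QsQ eqxx in sQ.
rewrite cards0 subn0 ![Omega :&: _]setIC.
have card1I P : #|[set P] :&: Omega| = (P \in Omega).
  case: (boolP (P \in Omega)) => PO; first by rewrite (setIidPl _) ?sub1set // cards1.
  by apply/eqP; rewrite cards_eq0 setI_eq0 disjoints1.
by rewrite !card1I; do 2!case: (_ \in _).
Qed.

(** [Omega] contains all fixed points of [sigma] and exactly one of [Q] and
    [sigma Q] otherwise, so [D] is the disjoint union of [Omega] and of the image
    of [Omega2] under [sigma]. *)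
Lemma prod_involution (R : comNzRingType) (G : {set 'I_n0} -> R) :
  \prod_(Q in D) G Q =
    (\prod_(Q in Omega1 sigma Omega) G Q) *
    \prod_(Q in Omega2 sigma Omega) (G Q * G (sigma Q)).
Proof.
rewrite (bigID (mem Omega)) big_split /= mulrA; congr (_ * _).
  rewrite (bigID (fun Q => sigma Q == Q)) /=; congr (_ * _); apply: eq_bigl => Q.
    by rewrite Omega1E; case: (boolP (Q \in Omega)) => [/Omega_sub->|]; rewrite ?andbF.
  by rewrite Omega2E; case: (boolP (Q \in Omega)) => [/Omega_sub->|]; rewrite ?andbF.
rewrite (reindex_onto sigma sigma) /=; last by move=> Q /andP[QD _]; apply: sigmaK.
apply: eq_bigl => Q; rewrite Omega2E; apply/andP/andP.
  case=> /andP[sQD sQN] /eqP ssQ.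
  have QD : Q \in D by rewrite -ssQ sigma_in.
  have sQ : sigma Q != Q.
    by apply: contraNneq sQN => sQ; rewrite sQ Omega_fixed.
  by split=> //; move: sQN; rewrite Omega_sigma // negbK.
case=> QO sQ; have QD := Omega_sub QO.
by rewrite sigma_in // sigmaK // Omega_sigma // QO.
Qed.

Variables h N : nat.
Hypothesis N_even : N = (h + h)%N.

(** On [D], the only possible balanced exponent that agrees with [b] on
    [Omega2], for [N = h + h]. *)
Definition extend_exponent b Q : nat :=
  if sigma Q == Q then h else if Q \in Omega then b Q else (N - b (sigma Q))%N.

Lemma extend_exponent_Omega2 b : {in Omega2 sigma Omega, extend_exponent b =1 b}.
Proof.
by move=> Q; rewrite Omega2E /extend_exponent => /andP[-> /negPf->].
Qed.

Lemma extend_exponent_balanced b : {in Omega2 sigma Omega, forall Q, (b Q <= N)%N} ->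
  balanced D sigma N (extend_exponent b).
Proof.
move=> b_le Q QD; rewrite /extend_exponent sigmaK // [Q == _]eq_sym.
have [//|sQ] := eqVneq (sigma Q) Q.
rewrite Omega_sigma //; case: ifPn => QO /=.
  by rewrite subnKC // b_le // Omega2E QO.
by rewrite subnK // b_le // Omega2E sigmaK // Omega_sigma // QO eq_sym.
Qed.

Lemma prod_balanced (R : comNzRingType) (f : {set 'I_n0} -> R) E :
    balanced D sigma N E ->
  \prod_(Q in D) f Q ^+ E Q =
    (\prod_(Q in Omega1 sigma Omega) f Q ^+ h) *
    \prod_(Q in Omega2 sigma Omega) (f Q ^+ E Q * f (sigma Q) ^+ (N - E Q)).
Proof.
move=> E_bal; rewrite prod_involution; congr (_ * _); apply: eq_bigr => Q.
  rewrite Omega1E => /andP[/Omega_sub /E_bal EQ /eqP sQ]; congr (_ ^+ _).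
  by apply: double_inj; rewrite -!addnn -N_even -EQ sQ.
rewrite Omega2E => /andP[/Omega_sub /E_bal EQ _].
by rewrite -EQ addKn.
Qed.

End InvolutionOrbits.

(** * Self-dual cyclic codes *)

Theorem corollary33
    (nu q k T n n0 r : nat) (F : finFieldType)
    (L : fieldType) (iota : {rmorphism F -> L}) (zeta : L)
    (Omega : {set {set 'I_n0}})
    (hnu : (1 <= nu)%N) (hq : q = (2 ^ nu)%N)
    (hT : (T < k)%N) (hF : #|F| = (q ^ k)%N)
    (hr : (1 <= r)%N) (hn0 : (1 <= n0)%N) (hodd : odd n0)
    (hn : n = (n0 * 2 ^ r)%N)
    (hzeta : n0.-primitive_root zeta)
    (theta := @frob_pow F q T)
    (sigma := @opp_mul_class n0 (q ^ T))
    (hsigma : {in cyclotomic_classes n0 (q ^ k),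
                forall Q, sigma (sigma Q) = Q})
    (hOmega : orbit_representatives sigma
                (cyclotomic_classes n0 (q ^ k)) Omega) :
  [/\ {in Omega2 sigma Omega, forall Q, #|fun_orbit sigma Q| = 2%N},
      (forall (C : {set 'rV[F]_n}) (g : {poly F}),
         cyclic_code C -> generator_poly C g ->
         (galois_self_dual theta C <->
          exists b : {set 'I_n0} -> nat,
            {in Omega2 sigma Omega, forall Q, (b Q <= 2 ^ r)%N} /\
            map_poly iota g =
              (\prod_(Q in Omega1 sigma Omega)
                  class_poly zeta Q ^+ (2 ^ (r - 1))) *
              (\prod_(Q in Omega2 sigma Omega)
                  (class_poly zeta Q ^+ b Q *
                   class_poly zeta (sigma Q) ^+ (2 ^ r - b Q)))))
    & #|[set C : {set 'rV[F]_n} | cyclic_code C & galois_self_dual theta C]| =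
      ((2 ^ r + 1) ^ #|Omega2 sigma Omega|)%N].
Proof.
have cardF : #|F| = (2 ^ (nu * k))%N by rewrite hF hq -expnM.
have chF : 2%N \in [pchar F] by apply: card_finPcharP cardF _.
have pnat2 t : (2%N).-nat (2 ^ t)%N by rewrite pnatX pnat_id.
have cardF_pnat : (2%N).-nat #|F| by rewrite cardF.
have qT_pnat : (2%N).-nat (q ^ T)%N by rewrite hq -expnM.
have chqT := pchar_pnat chF qT_pnat.
rewrite -hF in hsigma hOmega *; subst n.
have n_gt0 : (0 < n0 * 2 ^ r)%N by rewrite muln_gt0 hn0 expn_gt0.
set D := cyclotomic_classes n0 #|F| in hsigma hOmega *.
have sigma_in : {in D, forall Q, sigma Q \in D}.
  exact: opp_mul_class_in (pnat_coprime_order iota chF hzeta qT_pnat).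
have half : (2 ^ r = 2 ^ (r - 1) + 2 ^ (r - 1))%N.
  by rewrite addnn -mul2n -expnS subn1 prednK.
pose ext := extend_exponent sigma Omega (2 ^ (r - 1)) (2 ^ r).
have ext_bal b : {in Omega2 sigma Omega, forall Q, (b Q <= 2 ^ r)%N} ->
    balanced D sigma (2 ^ r) (ext b).
  exact: (extend_exponent_balanced hsigma hOmega half).
have extE b : {in Omega2 sigma Omega, ext b =1 b}.
  exact: (extend_exponent_Omega2 hsigma hOmega).
have prodE := prod_balanced sigma_in hsigma hOmega half (class_poly zeta).
have genP E g := balanced_generator (iota := iota) chF hr hzeta cardF_pnat
  chqT (E := E) (g := g).
have sdP g := self_dual_balanced iota chF hr hzeta cardF_pnat (chm := chqT) (g := g).
split.
- by move=> Q; apply: (card_orbit_Omega2 hsigma hOmega).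
- move=> C g C_cyc [g_monic g_dv ->]; split.
    case/(sdP g g_monic g_dv) => E E_bal ->.
    exists E; split; last exact: prodE.
    move=> Q; rewrite (Omega2E hsigma hOmega) => /andP[/(Omega_sub hOmega)/E_bal <- _].
    exact: leq_addr.
  case=> b [b_le gE]; have [//||//] := genP (ext b) g; first exact: ext_bal.
  rewrite gE (prodE _ (ext_bal b b_le)); congr (_ * _); apply: eq_bigr => Q QO.
  by rewrite !extE.
pose gen b := sval (prod_class_poly_descent iota chF hzeta cardF_pnat (ext b)).
have genE b : map_poly iota (gen b) = \prod_(Q in D) class_poly zeta Q ^+ ext b Q.
  exact: svalP (prod_class_poly_descent _ _ _ _ _).
pose B := {ffun {set 'I_n0} -> 'I_(2 ^ r).+1}.
(* Functions pinned to 0 off Omega2, so that distinct elements of X differ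
   in an exponent that the code sees. *)
pose X := [set b : B | b \in pffun_on ord0 (mem (Omega2 sigma Omega)) predT].
pose expo (b : B) Q : nat := b Q.
have expo_bal b : balanced D sigma (2 ^ r) (ext (expo b)).
  by apply: ext_bal => Q _; rewrite -ltnS ltn_ord.
have codeP b := genP _ _ (expo_bal b) (genE (expo b)).
transitivity #|[set ideal_code (n0 * 2 ^ r) (gen (expo b)) | b in X]|.
  apply: eq_card => C; rewrite inE; apply/andP/imsetP; last first.
    case=> b _ ->; have [g_monic g_dv g_sd] := codeP b.
    by rewrite ideal_code_cyclic.
  case=> C_cyc; have [g [g_monic g_dv ->]] := cyclic_code_has_generator n_gt0 C_cyc.
  case/(sdP g g_monic g_dv) => E E_bal gE.
  pose b : B := [ffun Q => if Q \in Omega2 sigma Omega then inord (E Q) else ord0].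
  exists b.
    rewrite inE; apply/pffun_onP; split=> //.
    by apply/subsetP=> Q; rewrite unfold_in /= ffunE; case: ifP; rewrite ?eqxx.
  congr ideal_code; apply: (map_poly_inj iota); rewrite gE genE.
  rewrite !prodE //; congr (_ * _); apply: eq_bigr => Q QO.
  rewrite !extE // /expo ffunE QO inordK // ltnS.
  move: QO; rewrite (Omega2E hsigma hOmega) => /andP[/(Omega_sub hOmega)/E_bal <- _].
  exact: leq_addr.
rewrite card_in_imset; first by rewrite cardsE card_pffun_on card_ord addn1.
move=> b1 b2; rewrite !inE => /pffun_onP[b1_supp _] /pffun_onP[b2_supp _].
have [m1 d1 _] := codeP b1; have [m2 d2 _] := codeP b2.
move/(ideal_code_inj n_gt0 m1 m2 d1 d2)/(congr1 (map_poly iota)); rewrite !genE.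
move/(prod_class_poly_inj iota chF hzeta cardF_pnat) => ext12.
apply/ffunP=> Q; have [QO|QNO] := boolP (Q \in Omega2 sigma Omega).
  have QD : Q \in D.
    by move: QO; rewrite (Omega2E hsigma hOmega) => /andP[/(Omega_sub hOmega)].
  by apply: val_inj; have := ext12 Q QD; rewrite !extE.
have supp0 (b : B) : ord0.-support b \subset mem (Omega2 sigma Omega) -> b Q = ord0.
  by move/subsetP/(_ Q)/contra/(_ QNO); rewrite unfold_in negbK => /eqP.
by rewrite !supp0.
Qed.
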